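(* Let $n\ge2$ and let $\mu=(\mu_1,\dots,\mu_n)\in\mathbb C^n$ be an arbitrary vector such that $\mu_i\ne\mu_j$ for $i\ne j$. The skew-symmetric rime classical $r$-matrix $$r=\sum_{i,j:\,i<j}\frac{Z^i_j\wedge Z^j_i}{\mu_i-\mu_j},\qquad Z^i_j=e^i_j-e^j_j,$$ belongs to the orbit of the parameter-free classical $r$-matrix $$b=\sum_{i,j:\,i<j}\ \sum_{k=1}^{j-i}e^{i+k}_i\wedge e^{j-k+1}_j .$$ More precisely, $$r=(\mathrm{Ad}_{X_\mu}\otimes\mathrm{Ad}_{X_\mu})(b),$$ where $X_\mu\in GL(n)$ is defined by $(X_\mu)^j_k=e_{k-1}(\mu_1,\dots,\hat\mu_j,\dots,\mu_n)$.
   Context: $\mathbb C^n$ has basis $e_1,\dots,e_n$; $e^i_j$ is the matrix unit $e^i_j(e_k)=\delta^i_ke_j$; entries of an operator $A$ are given by $A(e_k)=\sum_jA^j_ke_j$ (upper index is the row); $x\wedge y=x\otimes y-y\otimes x$; $\mathrm{Ad}_X(A)=XAX^{-1}$. In the formula for $X_\mu$, $e_m(\cdot)$ is the $m$-th elementary symmetric polynomial ($e_0=1$) and the hat means that $\mu_j$ is omitted. A classical $r$-matrix is a solution of $[r_{12},r_{13}]+[r_{12},r_{23}]+[r_{13},r_{23}]=0$. *)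

(* Defs.v *)
From HB Require Import structures.
From mathcomp Require Export all_boot all_order all_algebra.
From mathcomp Require Export reals.
From mathcomp Require Export complex mxtens.
From mathcomp Require Export mpoly.

Set Implicit Arguments.
Unset Strict Implicit.
Unset Printing Implicit Defensive.

Import Order.TTheory GRing.Theory Num.Theory.
Local Open Scope ring_scope.

(* Conventions.  K^n has basis e_0, ..., e_(n-1) (all indices are shifted down
   by one), operators act on columns, so A^j_k is the entry A j k, and the
   matrix unit e^i_j, which sends e_i to e_j, has its 1 in row j and column i.
   End(K^n) (x) End(K^n) is realised as 'M[K]_(n * n), and the triple tensor
   power as 'M[K]_(n * n * n), with *t for the tensor product of operators. *)

Section RMatrices.
Variables (K : fieldType) (n : nat).

(* e^i_j.  The indices are natural numbers, so that sums and differences such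
   as i + k and j - k + 1 can be used directly; it is 0 when i or j is not
   < n, which never happens below. *)
Definition eunit (i j : nat) : 'M[K]_n :=
  \matrix_(p < n, q < n) ((p == j :> nat) && (q == i :> nat))%:R.

Lemma eunitE (i j : 'I_n) : eunit i j = delta_mx j i.
Proof. by apply/matrixP=> p q; rewrite !mxE. Qed.

Definition wedge (A B : 'M[K]_n) : 'M[K]_(n * n) := A *t B - B *t A.

(* The linear map on End(K^n) (x) End(K^n) that sends A (x) B to phi A B, for
   phi bilinear, computed on the basis of pairs of matrix units. *)
Definition tens_ext (V : lmodType K) (phi : 'M[K]_n -> 'M[K]_n -> V)
    (T : 'M[K]_(n * n)) : V :=
  \sum_(i < n) \sum_(j < n) \sum_(k < n) \sum_(l < n)
    T (mxtens_index (i, k)) (mxtens_index (j, l))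
      *: phi (delta_mx i j) (delta_mx k l).

(* f (x) g, for linear maps f and g on End(K^n). *)
Definition tens_map (f g : 'M[K]_n -> 'M[K]_n) : 'M[K]_(n * n) -> 'M[K]_(n * n) :=
  tens_ext (fun A B => f A *t g B).

Definition Ad (X A : 'M[K]_n) : 'M[K]_n := X *m A *m invmx X.

Definition flip : 'M[K]_(n * n) -> 'M[K]_(n * n) :=
  tens_ext (fun A B => B *t A).

Definition leg12 : 'M[K]_(n * n) -> 'M[K]_(n * n * n) :=
  tens_ext (fun A B => A *t B *t (1%:M : 'M[K]_n)).
Definition leg13 : 'M[K]_(n * n) -> 'M[K]_(n * n * n) :=
  tens_ext (fun A B => A *t (1%:M : 'M[K]_n) *t B).
Definition leg23 : 'M[K]_(n * n) -> 'M[K]_(n * n * n) :=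
  tens_ext (fun A B => (1%:M : 'M[K]_n) *t A *t B).

Definition comm_bracket (m : nat) (A B : 'M[K]_m) : 'M[K]_m :=
  A *m B - B *m A.

Definition classical_r_matrix (T : 'M[K]_(n * n)) : Prop :=
  comm_bracket (leg12 T) (leg13 T) + comm_bracket (leg12 T) (leg23 T)
    + comm_bracket (leg13 T) (leg23 T) = 0.

Definition skew_symmetric (T : 'M[K]_(n * n)) : Prop := flip T = - T.

(* With T (e_k (x) e_l) = \sum_(i, j) T^(ij)_(kl) e_i (x) e_j, the entry
   T^(ij)_(kl) may be nonzero only if {k, l} is contained in {i, j}. *)
Definition rime (T : 'M[K]_(n * n)) : Prop :=
  forall i j k l : 'I_n, T (mxtens_index (i, j)) (mxtens_index (k, l)) != 0 ->
    [set k; l] \subset [set i; j].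

Definition in_orbit (b r : 'M[K]_(n * n)) : Prop :=
  exists X : 'M[K]_n, X \in unitmx /\ r = tens_map (Ad X) (Ad X) b.

Definition Zmx (i j : nat) : 'M[K]_n := eunit i j - eunit j j.

Definition rime_r (mu : 'I_n -> K) : 'M[K]_(n * n) :=
  \sum_(i < n) \sum_(j < n | (i < j)%N)
    (mu i - mu j)^-1 *: wedge (Zmx i j) (Zmx j i).

(* Shifting i and j down by one leaves the formula for b unchanged. *)
Definition param_free_b : 'M[K]_(n * n) :=
  \sum_(i < n) \sum_(j < n | (i < j)%N) \sum_(1 <= k < (j - i).+1)
    wedge (eunit (i + k) i) (eunit (j - k + 1) j).

(* Column k here is column k + 1 in 1-based numbering, hence degree k; the
   variable mu_j is omitted by means of lift j : 'I_n.-1 -> 'I_n. *)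
Definition Xmx (mu : 'I_n -> K) : 'M[K]_n :=
  \matrix_(j < n, k < n) (mesym n.-1 K k).@[fun i => mu (lift j i)].

End RMatrices.

Arguments param_free_b : clear implicits.

(* Main.v *)
From HB Require Import structures.
From mathcomp Require Import ring zify.
Require Import Defs.
Import GRing.Theory.
Local Open Scope ring_scope.
Local Open Scope complex_scope.

Set Implicit Arguments.
Unset Strict Implicit.
Unset Printing Implicit Defensive.

(** Let operators act on row vectors from the right, and read the row
    (v_0, ..., v_(n-1)) as the polynomial \sum_k v_k t^k.  A row of
    K^n (x) K^n is then a polynomial f(x, y), and b becomes the divided
    difference operator
      f(x, y) |-> x y (f(x, y) - f(y, x)) / (y - x).
    Row j of X_mu is P_j(t) = \prod_(i != j) (1 + mu_i t) ([XmxE]).  For j != l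
    put W = \prod_(i != j, l) (1 + mu_i t), so that P_j = W (1 + mu_l t) and
    P_l = W (1 + mu_j t).  Then b sends P_j(x) P_l(y) to
    (mu_j - mu_l) x y W(x) W(y).  On the other side, row (j, l) of r is
    (e_l - e_j) (x) (e_j - e_l) / (mu_l - mu_j) ([rime_rE]), which X_mu (x) X_mu
    maps to (P_l - P_j)(x) (P_j - P_l)(y) / (mu_l - mu_j).  As
    P_l - P_j = (mu_j - mu_l) t W, this is the same polynomial.  Hence
    (X_mu (x) X_mu) b = r (X_mu (x) X_mu) ([Xmx_intertwines]).  On coefficients
    the division by y - x is a telescoping sum along an antidiagonal
    ([antidiagonal_telescope]), so no bivariate polynomials appear below.

    X_mu is invertible because multiplying it by a matrix of powers of the
    - mu_l evaluates the reversed polynomials \prod_(i != j) (s + mu_i) at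
    s = - mu_l, which gives an invertible diagonal matrix ([Xmx_unit]).

    The Yang-Baxter equation is checked on r.  The three legs of r act on
    functions of three indices by four-term formulas, and the equation becomes a
    rational identity in three values of mu, with separate cases when two of the
    indices coincide ([rime_r_classical]).  Conjugation carries the equation
    from r to b ([classical_r_matrix_conj]).  The rime and skew-symmetry
    properties of r are read off its entries and its wedge form. *)

(** * Linear maps on tensor products of matrix spaces *)

Lemma sum_mxtens_index (V : nmodType) (m n : nat) (F : 'I_(m * n) -> V) :
  \sum_I F I = \sum_(i < m) \sum_(j < n) F (mxtens_index (i, j)).
Proof.
rewrite pair_big /= (reindex (@mxtens_index m n)) /=; last first.
  exists (@mxtens_unindex m n) => I _; first by rewrite mxtens_indexK.
  by rewrite mxtens_unindexK.
by apply: eq_bigr => -[i j].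
Qed.

Lemma mxtens_index_eq (m n : nat) (p q : 'I_m * 'I_n) :
  (mxtens_index p == mxtens_index q) = (p == q).
Proof. exact: (can_eq (@mxtens_indexK m n)). Qed.

Lemma tensmx_linearl (K : fieldType) (m n p q : nat) (B : 'M[K]_(p, q)) :
  linear (fun A : 'M[K]_(m, n) => A *t B).
Proof. by move=> a A A'; apply/matrixP => i j; rewrite !mxE; ring. Qed.

Lemma tensmx_linearr (K : fieldType) (m n p q : nat) (A : 'M[K]_(m, n)) :
  linear (fun B : 'M[K]_(p, q) => A *t B).
Proof. by move=> a B B'; apply/matrixP => i j; rewrite !mxE; ring. Qed.

Lemma tensmx11 (K : fieldType) (m n : nat) :
  (1%:M : 'M[K]_m) *t (1%:M : 'M[K]_n) = 1%:M.
Proof.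
apply/matrixP => I J.
case: (mxtens_indexP I) => a b; case: (mxtens_indexP J) => c d.
by rewrite tensmxE !mxE mxtens_index_eq xpair_eqE -natrM mulnb.
Qed.

Section TensExt.
Variables (K : fieldType) (n : nat).
Implicit Types (T : 'M[K]_(n * n)) (A B X Y : 'M[K]_n).

Section Target.
Variable V : lmodType K.
Implicit Types phi : 'M[K]_n -> 'M[K]_n -> V.

Lemma tens_ext_is_linear phi : linear (tens_ext phi).
Proof.
move=> a T T'; rewrite /tens_ext.
do 4![rewrite scaler_sumr -big_split /=; apply: eq_bigr => ? _].
by rewrite !mxE scalerDl scalerA.
Qed.
HB.instance Definition _ phi :=
  GRing.isLinear.Build K 'M[K]_(n * n) V _ (tens_ext phi)
    (tens_ext_is_linear phi).

Lemma eq_tens_ext phi phi' :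
  (forall A B, phi A B = phi' A B) -> tens_ext phi =1 tens_ext phi'.
Proof. by move=> e T; do 4![apply: eq_bigr => ? _]; rewrite e. Qed.

(** Bilinearity of [phi] is what makes the expression of [tens_ext] in the
    basis of matrix units the universal extension of [phi]. *)
Lemma tens_ext_tens phi A B :
    (forall B, linear (phi ^~ B)) -> (forall A, linear (phi A)) ->
  tens_ext phi (A *t B) = phi A B.
Proof.
move=> linl linr.
pose l B' : {linear 'M[K]_n -> V} :=
  HB.pack (phi ^~ B') (GRing.isLinear.Build _ _ _ _ _ (linl B')).
pose r A' : {linear 'M[K]_n -> V} :=
  HB.pack (phi A') (GRing.isLinear.Build _ _ _ _ _ (linr A')).
rewrite [in RHS](matrix_sum_delta A) -[RHS]/(l B _) linear_sum.
apply: eq_bigr => i _; rewrite linear_sum; apply: eq_bigr => j _.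
rewrite linearZ /= [in RHS](matrix_sum_delta B) -[phi _ _]/(r _ _).
rewrite linear_sum scaler_sumr; apply: eq_bigr => k _.
rewrite linear_sum scaler_sumr; apply: eq_bigr => m _.
by rewrite linearZ /= scalerA tensmxE.
Qed.

Lemma linear_tens_ext (W : lmodType K) (L : {linear V -> W}) phi T :
  L (tens_ext phi T) = tens_ext (fun A B => L (phi A B)) T.
Proof.
rewrite /tens_ext; do 4![rewrite linear_sum; apply: eq_bigr => ? _].
by rewrite linearZ.
Qed.

End Target.

Lemma tens_ext_id T : tens_ext (fun A B => A *t B) T = T.
Proof.
rewrite [RHS]matrix_sum_delta sum_mxtens_index; apply: eq_bigr => i _.
rewrite exchange_big; apply: eq_bigr => k _ /=.
rewrite sum_mxtens_index; apply: eq_bigr => j _; apply: eq_bigr => l _.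
congr (_ *: _); apply/matrixP => I J.
case: (mxtens_indexP I) => a b; case: (mxtens_indexP J) => c d.
rewrite tensmxE !mxE !mxtens_index_eq !xpair_eqE -natrM mulnb.
by congr (nat_of_bool _)%:R; rewrite !andbA; congr andb; rewrite andbAC.
Qed.

(** Conjugation acts factorwise on pure tensors, and these span. *)
Lemma tens_ext_conj (V : lmodType K) (phi : 'M[K]_n -> 'M[K]_n -> V) X Y T :
    (forall B, linear (phi ^~ B)) -> (forall A, linear (phi A)) ->
  tens_ext phi ((X *t X) *m T *m (Y *t Y)) =
  tens_ext (fun A B => phi (X *m A *m Y) (X *m B *m Y)) T.
Proof.
move=> linl linr.
rewrite -[in LHS](tens_ext_id T) (linear_tens_ext (mulmx _)).
rewrite -[_ *m (Y *t Y)]/(mulmxr (Y *t Y) _) (linear_tens_ext (mulmxr _)).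
rewrite (linear_tens_ext (tens_ext phi)).
by apply: eq_tens_ext => A B; rewrite /= !tensmx_mul tens_ext_tens.
Qed.

(** An entry of [tens_ext phi T] is a linear function of [T], so it is known
    once it is known on pure tensors. *)
Lemma tens_ext_entry (p q : nat) (phi : 'M[K]_n -> 'M[K]_n -> 'M[K]_(p, q))
    (I : 'I_p) (J : 'I_q) (I' J' : 'I_(n * n)) (s : K) T :
    (forall A B, phi A B I J = (A *t B) I' J' * s) ->
  tens_ext phi T I J = T I' J' * s.
Proof.
move=> e; rewrite -[in RHS](tens_ext_id T) /tens_ext.
do 4![rewrite !summxE mulr_suml; apply: eq_bigr => ? _].
by rewrite !mxE e -mulrA !mxE.
Qed.

Lemma tens_map_Ad X T :
  tens_map (Ad X) (Ad X) T = (X *t X) *m T *m (invmx X *t invmx X).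
Proof.
rewrite -[RHS]tens_ext_id tens_ext_conj //.
  exact: tensmx_linearl.
exact: tensmx_linearr.
Qed.

Lemma flip_tens A B : flip (A *t B) = B *t A.
Proof.
rewrite /flip tens_ext_tens //.
  exact: tensmx_linearr.
exact: tensmx_linearl.
Qed.

Lemma flip_wedge A B : flip (wedge A B) = - wedge A B.
Proof. by rewrite /wedge [LHS]linearB /= -!/(flip _) !flip_tens opprB. Qed.

(** * Conjugation preserves the classical Yang-Baxter equation *)

Section Conj.
Variables X Y : 'M[K]_n.
Hypothesis XY1 : X *m Y = 1%:M.

Let X3 := X *t X *t X.
Let Y3 := Y *t Y *t Y.

Lemma tens_ext_conj3 phi T :
    (forall B, linear (phi ^~ B)) -> (forall A, linear (phi A)) ->
    (forall A B, phi (X *m A *m Y) (X *m B *m Y) = X3 *m phi A B *m Y3) ->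
  tens_ext phi ((X *t X) *m T *m (Y *t Y)) = X3 *m tens_ext phi T *m Y3.
Proof.
move=> linl linr e; rewrite tens_ext_conj // (eq_tens_ext e).
rewrite (linear_tens_ext (mulmx X3)) -[RHS]/(mulmxr Y3 _).
by rewrite (linear_tens_ext (mulmxr Y3)).
Qed.

Lemma leg12_conj T :
  leg12 ((X *t X) *m T *m (Y *t Y)) = X3 *m leg12 T *m Y3.
Proof.
apply: tens_ext_conj3 => [B a A A'|A a B B'|A B].
- by rewrite !tensmx_linearl.
- by rewrite tensmx_linearr tensmx_linearl.
- by rewrite !tensmx_mul mulmx1 XY1.
Qed.

Lemma leg13_conj T :
  leg13 ((X *t X) *m T *m (Y *t Y)) = X3 *m leg13 T *m Y3.
Proof.
apply: tens_ext_conj3 => [B a A A'|A a B B'|A B].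
- by rewrite !tensmx_linearl.
- by rewrite tensmx_linearr.
- by rewrite !tensmx_mul mulmx1 XY1.
Qed.

Lemma leg23_conj T :
  leg23 ((X *t X) *m T *m (Y *t Y)) = X3 *m leg23 T *m Y3.
Proof.
apply: tens_ext_conj3 => [B a A A'|A a B B'|A B].
- by rewrite tensmx_linearr tensmx_linearl.
- by rewrite tensmx_linearr.
- by rewrite !tensmx_mul mulmx1 XY1.
Qed.

(** All three legs are conjugated by the same operator X (x) X (x) X, which
    factors out of the commutators. *)
Lemma classical_r_matrix_conj T :
  classical_r_matrix T -> classical_r_matrix ((X *t X) *m T *m (Y *t Y)).
Proof.
have YX3 : Y3 *m X3 = 1%:M.
  by rewrite !tensmx_mul (mulmx1C XY1) !tensmx11.
have brk (A B : 'M[K]_(n * n * n)) :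
    comm_bracket (X3 *m A *m Y3) (X3 *m B *m Y3) =
    X3 *m comm_bracket A B *m Y3.
  rewrite /comm_bracket mulmxBr mulmxBl; congr (_ - _);
  by rewrite !mulmxA -[in LHS](mulmxA _ Y3) YX3 mulmx1.
rewrite /classical_r_matrix => cybe.
rewrite leg12_conj leg13_conj leg23_conj !brk -!mulmxDl -!mulmxDr.
by rewrite cybe mulmx0 mul0mx.
Qed.

End Conj.

Local Notation idx3 a b c := (mxtens_index (mxtens_index (a, b), c)).

(** * Entries of the legs *)

Lemma leg12E T a b c a' b' c' :
  leg12 T (idx3 a b c) (idx3 a' b' c') =
  T (mxtens_index (a, b)) (mxtens_index (a', b')) * (c == c')%:R.
Proof. by apply: tens_ext_entry => A B; rewrite !tensmxE !mxE. Qed.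

Lemma leg13E T a b c a' b' c' :
  leg13 T (idx3 a b c) (idx3 a' b' c') =
  T (mxtens_index (a, c)) (mxtens_index (a', c')) * (b == b')%:R.
Proof. by apply: tens_ext_entry => A B; rewrite !tensmxE !mxE mulrAC. Qed.

Lemma leg23E T a b c a' b' c' :
  leg23 T (idx3 a b c) (idx3 a' b' c') =
  T (mxtens_index (b, c)) (mxtens_index (b', c')) * (a == a')%:R.
Proof.
by apply: tens_ext_entry => A B; rewrite !tensmxE !mxE -mulrA mulrC.
Qed.

End TensExt.

Lemma sum_delta (K : nzRingType) (n : nat) (a : 'I_n) (F : 'I_n -> K) :
  \sum_i (i == a)%:R * F i = F a.
Proof.
rewrite (bigD1 a) //= eqxx mul1r big1 ?addr0 // => i /negPf->.
by rewrite mul0r.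
Qed.

Lemma sum_pair_delta (K : nzRingType) (n : nat) (a b : 'I_n)
    (F : 'I_n -> 'I_n -> K) :
  \sum_(i < n) \sum_(j < n | (i < j)%N) (i == a)%:R * (j == b)%:R * F i j =
  (a < b)%N%:R * F a b.
Proof.
rewrite -(sum_delta b (fun j => (a < j)%N%:R * F a j)).
rewrite -(sum_delta a (fun i => \sum_j (j == b)%:R * ((i < j)%N%:R * F i j))).
apply: eq_bigr => i _; rewrite mulr_sumr big_mkcond; apply: eq_bigr => j _.
by case: ifP => _; rewrite ?mul1r ?mul0r ?mulr0 ?mulrA.
Qed.

(** * The rime r-matrix *)

Section RimeR.
Variables (K : fieldType) (n : nat) (mu : 'I_n -> K).
Hypothesis mu_inj : forall i j, i != j -> mu i != mu j.

Local Notation weight a b := (mu b - mu a)^-1.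
Local Notation idx3 a b c := (mxtens_index (mxtens_index (a, b), c)).

Lemma ZmxE (i j a p : 'I_n) :
  Zmx K n i j a p = (a == j)%:R * ((p == i)%:R - (p == j)%:R).
Proof. by rewrite !mxE mulrBr -!natrM !mulnb. Qed.

(** Exchanging i and j changes the sign of both the wedge and mu_i - mu_j, so r
    is the sum of Z^i_j (x) Z^j_i / (mu_i - mu_j) over all i != j.  Only the
    term with j = a and i = b meets row (a, b).  On the diagonal a = b the right
    side is 0, thanks to the convention 0^-1 = 0. *)
Lemma rime_rE (a b p q : 'I_n) :
  rime_r mu (mxtens_index (a, b)) (mxtens_index (p, q)) =
  weight a b * ((p == b)%:R - (p == a)%:R) * ((q == a)%:R - (q == b)%:R).
Proof.
rewrite summxE.
pose F i j : K := - weight i j *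
  ((p == j)%:R - (p == i)%:R) * ((q == i)%:R - (q == j)%:R).
transitivity
  (\sum_(i < n) \sum_(j < n | (i < j)%N) (i == b)%:R * (j == a)%:R * F i j -
   \sum_(i < n) \sum_(j < n | (i < j)%N) (i == a)%:R * (j == b)%:R * F i j).
  rewrite -sumrB; apply: eq_bigr => i _; rewrite summxE -sumrB.
  apply: eq_bigr => j _; rewrite 2!mxE [in X in _ * (_ + X)]mxE !tensmxE !ZmxE.
  rewrite /F -invrN opprB !(eq_sym i) !(eq_sym j).
  by ring.
rewrite !sum_pair_delta /F -(opprB (mu b) (mu a)) invrN.
(* Only one of the two sums survives when a != b, and none when a = b. *)
case: ltngtP => [_|_|/val_inj ->] /=; last rewrite subrr invr0; ring.
Qed.

Lemma sum_diff_delta (a b : 'I_n) (F : 'I_n -> K) :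
  \sum_i ((i == a)%:R - (i == b)%:R) * F i = F a - F b.
Proof.
by rewrite (eq_bigr _ (fun i _ => mulrBl _ _ _)) sumrB !sum_delta.
Qed.

Lemma rime_r_mul (m : nat) (N : 'M[K]_(n * n, m)) a b x :
  (rime_r mu *m N) (mxtens_index (a, b)) x = weight a b *
    (N (mxtens_index (b, a)) x - N (mxtens_index (b, b)) x
     - (N (mxtens_index (a, a)) x - N (mxtens_index (a, b)) x)).
Proof.
rewrite mxE sum_mxtens_index.
rewrite -(sum_diff_delta a b (fun q => N (mxtens_index (b, q)) x)).
rewrite -(sum_diff_delta a b (fun q => N (mxtens_index (a, q)) x)).
rewrite -(sum_diff_delta b a (fun p => \sum_q _ * N (mxtens_index (p, q)) x)).
rewrite mulr_sumr; apply: eq_bigr => p _.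
rewrite !mulr_sumr; apply: eq_bigr => q _.
by rewrite rime_rE !mulrA.
Qed.

(** Each leg acts on two of the three indices as r does, the remaining index
    being a parameter: [N'] is the slice of [N] at that parameter. *)
Lemma leg12_rime_r_mul (m : nat) (N : 'M[K]_(n * n * n, m)) a b d x :
  (leg12 (rime_r mu) *m N) (idx3 a b d) x = weight a b *
    (N (idx3 b a d) x - N (idx3 b b d) x
     - (N (idx3 a a d) x - N (idx3 a b d) x)).
Proof.
pose N' := \matrix_(I, y) N (mxtens_index (I, d)) y.
transitivity ((rime_r mu *m N') (mxtens_index (a, b)) x); last first.
  by rewrite rime_r_mul !mxE.
rewrite !mxE !sum_mxtens_index; apply: eq_bigr => a' _; apply: eq_bigr => b' _.
rewrite mxE -(sum_delta d (fun d' => _ * N (mxtens_index (_, d')) x)).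
by apply: eq_bigr => d' _; rewrite leg12E (eq_sym d); ring.
Qed.

Lemma leg13_rime_r_mul (m : nat) (N : 'M[K]_(n * n * n, m)) a b d x :
  (leg13 (rime_r mu) *m N) (idx3 a b d) x = weight a d *
    (N (idx3 d b a) x - N (idx3 d b d) x
     - (N (idx3 a b a) x - N (idx3 a b d) x)).
Proof.
pose N' := \matrix_(I, y)
  N (idx3 (mxtens_unindex I).1 b (mxtens_unindex I).2) y.
transitivity ((rime_r mu *m N') (mxtens_index (a, d)) x); last first.
  by rewrite rime_r_mul !mxE !mxtens_indexK.
rewrite !mxE !sum_mxtens_index; apply: eq_bigr => a' _.
rewrite exchange_big; apply: eq_bigr => d' _ /=.
rewrite mxE mxtens_indexK /= -(sum_delta b (fun b' => _ * N (idx3 _ b' _) x)).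
by apply: eq_bigr => b' _; rewrite leg13E (eq_sym b); ring.
Qed.

Lemma leg23_rime_r_mul (m : nat) (N : 'M[K]_(n * n * n, m)) a b d x :
  (leg23 (rime_r mu) *m N) (idx3 a b d) x = weight b d *
    (N (idx3 a d b) x - N (idx3 a d d) x
     - (N (idx3 a b b) x - N (idx3 a b d) x)).
Proof.
pose N' := \matrix_(I, y)
  N (idx3 a (mxtens_unindex I).1 (mxtens_unindex I).2) y.
transitivity ((rime_r mu *m N') (mxtens_index (b, d)) x); last first.
  by rewrite rime_r_mul !mxE !mxtens_indexK.
rewrite !mxE !sum_mxtens_index exchange_big; apply: eq_bigr => b' _ /=.
rewrite exchange_big; apply: eq_bigr => d' _ /=.
rewrite mxE mxtens_indexK /= -(sum_delta a (fun a' => _ * N (idx3 a' _ _) x)).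
by apply: eq_bigr => a' _; rewrite leg23E (eq_sym a); ring.
Qed.

Lemma weightN a b : weight b a = - weight a b.
Proof. by rewrite -invrN opprB. Qed.

Lemma weight0 a : weight a a = 0.
Proof. by rewrite subrr invr0. Qed.

(** Applied to an arbitrary [N], the equation at row (a, b, d) is linear in the
    entries of [N] whose row indices lie in {a, b, d}.  For distinct indices its
    coefficients are multiples of the Arnold relation
    w_ab w_bd = w_ad (w_ab + w_bd), where w_ab = 1 / (mu_b - mu_a).  That
    relation fails when two indices coincide, but then the weights are 0 or
    equal up to sign, and the terms cancel by themselves. *)
Lemma rime_r_classical : classical_r_matrix (rime_r mu).
Proof.
rewrite /classical_r_matrix /comm_bracket; apply/matrixP => I x.
have addE (A B : 'M[K]_(n * n * n)) i j : (A + B) i j = A i j + B i j.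
  by rewrite mxE.
have oppE (A : 'M[K]_(n * n * n)) i j : (- A) i j = - A i j by rewrite mxE.
set S := (X in fun_of_matrix X I x); rewrite -(mulmx1 S) {}/S.
(* With an explicit right factor the products become iterated actions. *)
move: (1%:M : 'M[K]_(n * n * n)) => N.
rewrite !mulmxDl !mulNmx -!mulmxA [RHS]mxE.
case: (mxtens_indexP I) => J d; case: (mxtens_indexP J) => a b.
rewrite !addE !oppE.
rewrite !(leg12_rime_r_mul, leg13_rime_r_mul, leg23_rime_r_mul).
have [->|ab] := eqVneq a b.
  by rewrite !weight0 !(weightN b d); ring.
have [->|bd] := eqVneq b d.
  by rewrite !weight0 !(weightN a d); ring.
have [->|ad] := eqVneq a d.
  by rewrite !weight0 !(weightN d b); ring.
have ne i j : i != j -> mu i - mu j != 0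
  by move=> ij; rewrite subr_eq0 mu_inj.
by field; rewrite !ne // eq_sym.
Qed.

End RimeR.

(** * The parameter-free r-matrix *)

(** The row (a, c) of b holds the coefficients of
    x y (x^a y^c - x^c y^a) / (y - x): for a < c this is the sum of x^p y^q over
    p + q = a + c + 1 with a < p and a < q, and the expression is
    antisymmetric in (a, c). *)
Lemma param_free_bE (K : fieldType) (n : nat) (a c p q : 'I_n) :
  param_free_b K n (mxtens_index (a, c)) (mxtens_index (p, q)) =
  (a + c + 1 == p + q)%N%:R *
    ((a < minn p q)%N%:R - (c < minn p q)%N%:R).
Proof.
pose G (p q i j : 'I_n) : K := \sum_(1 <= k < (j - i).+1)
  (p == i + k :> nat)%N%:R * (q == j - k + 1 :> nat)%N%:R.
have GE (p' q' i j : 'I_n) :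
    G p' q' i j = ((i < p' <= j) && (i + j + 1 == p' + q'))%N%:R.
  rewrite /G; transitivity
      (\sum_(1 <= k < (j - i).+1 | (k == p' - i)%N)
         (i + j + 1 == p' + q')%N%:R : K).
    rewrite [RHS]big_mkcond; apply: eq_big_nat => k hk.
    rewrite -natrM mulnb -[RHS]/(if _ then _ else 0%:R).
    by case: ifP => h; congr (_%:R); lia.
  rewrite big_nat1_eq -[LHS]/(if _ then _ else 0%:R).
  by case: ifP => h; congr (_%:R); lia.
transitivity
  (\sum_(i < n) \sum_(j < n | (i < j)%N) (i == a)%:R * (j == c)%:R * G p q i j -
   \sum_(i < n) \sum_(j < n | (i < j)%N) (i == c)%:R * (j == a)%:R * G q p i j).
  rewrite summxE -sumrB; apply: eq_bigr => i _.
  rewrite summxE -sumrB; apply: eq_bigr => j _.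
  rewrite summxE /G !mulr_sumr -sumrB; apply: eq_bigr => k _.
  rewrite mxE [in X in _ + X]mxE !tensmxE !mxE.
  rewrite -!(inj_eq val_inj) /= -!natrM !mulnb.
  rewrite !(eq_sym (val i)) !(eq_sym (val j)).
  by congr (_%:R - _%:R); rewrite -!andbA /=; do 4!case: (_ == _).
rewrite !sum_pair_delta !GE.
rewrite mulrBr -!natrM !mulnb; congr (_%:R - _%:R); lia.
Qed.

(** * The rows of X as polynomials *)

Lemma meval_mesym (A : comNzRingType) (m k : nat) (c : 'I_m -> A) :
  (mesym m A k).@[c] = \sum_(h : {set 'I_m} | #|h| == k) \prod_(i in h) c i.
Proof.
rewrite rmorph_sum; apply: eq_bigr => h _.
by rewrite rmorph_prod; apply: eq_bigr => i _; rewrite /= mevalXU.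
Qed.

(** Vieta's formula in homogeneous form, so that it can be specialised both to
    polynomials in t (s = 1) and to values at s (t = 1). *)
Lemma prod_linear_mesym (A : comNzRingType) (m : nat) (c : 'I_m -> A)
    (s t : A) :
  \prod_i (s + c i * t) =
  \sum_(k < m.+1) (mesym m A k).@[c] * s ^+ (m - k) * t ^+ k.
Proof.
have card_lt (h : {set 'I_m}) : (#|h| < m.+1)%N.
  by rewrite ltnS -[m in leqRHS]card_ord max_card.
under eq_bigr do rewrite addrC.
rewrite bigA_distr (partition_big (fun h => Ordinal (card_lt h)) predT) //=.
apply: eq_bigr => k _; rewrite meval_mesym !mulr_suml.
apply: eq_big => [h|h /eqP hk]; first by rewrite -val_eqE.
rewrite big_if /= !big_split /= !prodr_const mulrAC.
congr (_ * _ * _ ^+ _); rewrite -?hk //.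
congr (_ ^+ _); apply: (canRL (addKn _)).
by rewrite -[RHS]card_ord -(cardC (mem h)).
Qed.

Lemma prod_lift (A : comNzRingType) (n : nat) (j : 'I_n) (F : 'I_n -> A) :
  \prod_(i < n.-1) F (lift j i) = \prod_(i | i != j) F i.
Proof.
rewrite (reindex_omap (lift j) (unlift j)) => [|i].
  by apply: eq_bigl => i; rewrite liftK eqxx eq_sym neq_lift.
by rewrite eq_sym => /unlift_some[k -> ->].
Qed.

Section Interpolation.
Variables (K : fieldType) (n : nat) (mu : 'I_n -> K).

Lemma Xmx_homogeneous (j : 'I_n) (s t : K) :
  \sum_(k < n) Xmx mu j k * s ^+ (n.-1 - k) * t ^+ k =
  \prod_(i | i != j) (s + mu i * t).
Proof.
rewrite -prod_lift prod_linear_mesym (ltn_predK (ltn_ord j)).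
by apply: eq_bigr => k _; rewrite mxE.
Qed.

(** Lagrange interpolation: the values of \prod_(i != j) (s + mu_i) at
    s = - mu_l vanish for l != j, so X times a matrix of powers is diagonal. *)
Lemma Xmx_unit : (forall i j, i != j -> mu i != mu j) -> Xmx mu \in unitmx.
Proof.
move=> mu_inj.
pose V : 'M[K]_n := \matrix_(k, i) (- mu i) ^+ (n.-1 - k).
pose d : 'rV[K]_n := \row_j \prod_(i | i != j) (mu i - mu j).
suff: Xmx mu *m V \in unitmx by rewrite unitmx_mul => /andP[].
have -> : Xmx mu *m V = diag_mx d.
  apply/matrixP => j i; rewrite [RHS]mxE [LHS]mxE mxE.
  transitivity (\prod_(l | l != j) (- mu i + mu l * 1)).
    rewrite -Xmx_homogeneous; apply: eq_bigr => k _.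
    by rewrite !mxE expr1n mulr1.
  case: eqVneq => [->|ij]; first by apply: eq_bigr => l _; rewrite mulr1 addrC.
  by rewrite (bigD1 i) 1?eq_sym //= mulr1 addNr mul0r.
rewrite unitmxE unitfE det_diag; apply/prodf_neq0 => j _; rewrite mxE.
by apply/prodf_neq0 => i ij; rewrite subr_eq0 mu_inj.
Qed.

Definition row_poly (j : 'I_n) : {poly K} :=
  \prod_(i | i != j) (1 + (mu i)%:P * 'X).

Lemma row_polyE (j : 'I_n) :
  row_poly j = \poly_(k < n) (mesym n.-1 K k).@[fun i => mu (lift j i)].
Proof.
rewrite /row_poly -prod_lift (prod_linear_mesym (fun i => (mu (lift j i))%:P)).
rewrite (ltn_predK (ltn_ord j)) poly_def; apply: eq_bigr => k _.
rewrite expr1n mulr1 !meval_mesym -mul_polyC rmorph_sum; congr (_ * _).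
by apply: eq_bigr => h _; rewrite rmorph_prod.
Qed.

Lemma XmxE (j k : 'I_n) : Xmx mu j k = (row_poly j)`_k.
Proof. by rewrite row_polyE coef_poly ltn_ord mxE. Qed.

Lemma coef_row_poly_ge (j : 'I_n) k : (n <= k)%N -> (row_poly j)`_k = 0.
Proof. by rewrite row_polyE coef_poly ltnNge => ->. Qed.

(** * The conjugation identity *)

(** The coefficient of x^p y^q in
    x y (P_j(x) P_l(y) - P_j(y) P_l(x)) / (y - x).  The two families of nonzero
    entries of b, with a < min(p, q) and with c < min(p, q), give the two
    terms. *)
Lemma Xmx_mul_b_entry (j l p q : 'I_n) :
  ((Xmx mu *t Xmx mu) *m param_free_b K n)
      (mxtens_index (j, l)) (mxtens_index (p, q)) =
  \sum_(m < minn p q) ((row_poly j)`_m * (row_poly l)`_((p + q).-1 - m) -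
     (row_poly j)`_((p + q).-1 - m) * (row_poly l)`_m).
Proof.
set P := row_poly j; set Q := row_poly l; set M := minn p q.
set N := (p + q).-1.
pose S (F G : {poly K}) :=
  \sum_(a < n) \sum_(c < n)
    (a < M)%N%:R * ((a + c + 1)%N == (p + q)%N)%:R * (F`_a * G`_c).
have SE (i i' : 'I_n) : S (row_poly i) (row_poly i') =
    \sum_(m < M) (row_poly i)`_m * (row_poly i')`_(N - m).
  pose f m := (row_poly i)`_m * (row_poly i')`_(N - m).
  rewrite (big_ord_widen_cond n xpredT f) ?geq_min ?(ltnW (ltn_ord p)) //.
  rewrite /S [RHS]big_mkcond; apply: eq_bigr => a _ /=.
  case: ifP => aM; last by rewrite big1 // => c _; rewrite !mul0r.
  transitivity
    (\sum_(c < n | (c == N - a :> nat)%N) (row_poly i)`_a * (row_poly i')`_c).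
    rewrite [RHS]big_mkcond; apply: eq_bigr => c _ /=; rewrite mul1r.
    have -> : (a + c + 1 == p + q)%N = (c == N - a :> nat)%N by lia.
    by case: eqP => _; rewrite ?mul1r ?mul0r.
  rewrite (big_ord1_eq _ (fun c => (row_poly i)`_a * (row_poly i')`_c)).
  case: ltnP => // h.
  (* Beyond the size of the matrix the coefficient vanishes anyway. *)
  by rewrite /f [X in _ * X]coef_row_poly_ge ?mulr0.
transitivity (S P Q - S Q P).
  rewrite mxE sum_mxtens_index [X in _ - X]exchange_big -sumrB.
  apply: eq_bigr => a _; rewrite -sumrB; apply: eq_bigr => c _ /=.
  rewrite tensmxE !XmxE param_free_bE (addnC c a).
  by rewrite -/P -/Q -/M; ring.
by rewrite !SE -sumrB; apply: eq_bigr => m _; rewrite [X in _ - X]mulrC.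
Qed.

(** The division by y - x in the identity
    (y - x) W(x) W(y) = W(x) (y W(y)) - (x W(x)) W(y): on coefficients, the
    partial sums of the right side are products of two coefficients. *)
Lemma antidiagonal_telescope (W : {poly K}) (p q : nat) :
  \sum_(m < minn p q) ((W`_m) * (W * 'X)`_((p + q).-1 - m) -
     (W`_((p + q).-1 - m)) * (W * 'X)`_m) =
  (W * 'X)`_p * (W * 'X)`_q.
Proof.
pose u m := (W * 'X)`_m * (W * 'X)`_((p + q) - m).
rewrite (eq_bigr (fun m : 'I__ => u m.+1 - u m)); last first.
  move=> m _; have := ltn_ord m; rewrite leq_min => /andP[mp mq].
  rewrite /u !coefMX /=.
  have -> : ((p + q).-1 - m == 0)%N = (p + q - m.+1 == 0)%N by lia.
  have -> : (p + q - m == 0)%N = false by lia.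
  have -> : ((p + q).-1 - m = p + q - m.+1)%N by lia.
  have -> : ((p + q - m).-1 = p + q - m.+1)%N by lia.
  by case: (m : nat) => [|?] /=; ring.
rewrite -(big_mkord xpredT (fun m => u m.+1 - u m)) telescope_sumr //.
rewrite [X in _ - X](_ : u 0 = 0) ?subr0; last by rewrite /u coefMX mul0r.
case: leqP => _.
  by rewrite /u addKn.
by rewrite /u addnK mulrC.
Qed.

(** Both sides have rows (mu_j - mu_l) x y W(x) W(y), where W is the product
    over all indices other than j and l. *)
Lemma Xmx_intertwines : (forall i j, i != j -> mu i != mu j) ->
  (Xmx mu *t Xmx mu) *m param_free_b K n = rime_r mu *m (Xmx mu *t Xmx mu).
Proof.
move=> mu_inj; apply/matrixP => I J.
case: (mxtens_indexP I) => j l; case: (mxtens_indexP J) => p q.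
rewrite Xmx_mul_b_entry rime_r_mul !tensmxE !XmxE.
have [<-|jl] := eqVneq j l.
  rewrite subrr invr0 mul0r big1 // => m _.
  by rewrite mulrC subrr.
pose W := \prod_(i | (i != j) && (i != l)) (1 + (mu i)%:P * 'X).
have Pj : row_poly j = W + (mu l)%:P * (W * 'X).
  by rewrite /row_poly (bigD1 l) 1?eq_sym //= -/W; ring.
have Pl : row_poly l = W + (mu j)%:P * (W * 'X).
  rewrite /row_poly (bigD1 j) //=; under eq_bigl do rewrite andbC; rewrite -/W.
  by ring.
transitivity ((mu j - mu l) * ((W * 'X)`_p * (W * 'X)`_q)).
  rewrite -antidiagonal_telescope mulr_sumr; apply: eq_bigr => m _.
  by rewrite Pj Pl !(coefD, coefCM); ring.
rewrite Pj Pl !(coefD, coefCM).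
have : mu l - mu j != 0 by rewrite subr_eq0 mu_inj // eq_sym.
by move=> h; field.
Qed.

Lemma rime_r_Ad : (forall i j, i != j -> mu i != mu j) ->
  rime_r mu = tens_map (Ad (Xmx mu)) (Ad (Xmx mu)) (param_free_b K n).
Proof.
move=> mu_inj; rewrite tens_map_Ad Xmx_intertwines // -mulmxA tensmx_mul.
by rewrite mulmxV ?Xmx_unit // tensmx11 mulmx1.
Qed.

Lemma param_free_b_Ad : (forall i j, i != j -> mu i != mu j) ->
  param_free_b K n =
  (invmx (Xmx mu) *t invmx (Xmx mu)) *m rime_r mu *m (Xmx mu *t Xmx mu).
Proof.
move=> mu_inj; rewrite -mulmxA -Xmx_intertwines // mulmxA tensmx_mul.
by rewrite mulVmx ?Xmx_unit // tensmx11 mul1mx.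
Qed.

Lemma rime_r_skew : skew_symmetric (rime_r mu).
Proof.
rewrite /skew_symmetric /rime_r /flip [LHS]linear_sum -sumrN.
apply: eq_bigr => i _.
rewrite linear_sum -sumrN; apply: eq_bigr => j _.
by rewrite linearZ /= -/(flip _) flip_wedge scalerN.
Qed.

Lemma rime_r_rime : rime (rime_r mu).
Proof.
move=> i j k l; rewrite rime_rE => h.
apply/subsetP => x; rewrite !inE => /orP[]/eqP->; apply: contraNT h;
  rewrite negb_or => /andP[/negPf-> /negPf->].
  by rewrite subrr mulr0 mul0r.
by rewrite subrr mulr0.
Qed.

End Interpolation.

Theorem proposition7 (R : realType) (n : nat) (hn : (2 <= n)%N)
    (mu : 'I_n -> R[i]) (hmu : forall i j : 'I_n, i != j -> mu i != mu j) :
  let r := rime_r mu in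
  let b := param_free_b R[i] n in
  [/\ skew_symmetric r, rime r & classical_r_matrix r] /\
  classical_r_matrix b /\
  in_orbit b r /\
  Xmx mu \in unitmx /\
  r = tens_map (Ad (Xmx mu)) (Ad (Xmx mu)) b.
Proof.
move=> r b.
have X_unit : Xmx mu \in unitmx by exact: Xmx_unit.
have rE : r = tens_map (Ad (Xmx mu)) (Ad (Xmx mu)) b by exact: rime_r_Ad.
split; first by split; [exact: rime_r_skew | exact: rime_r_rime
                       | exact: rime_r_classical].
split; last by split=> //; exists (Xmx mu).
rewrite /b (param_free_b_Ad hmu); apply: classical_r_matrix_conj.
  exact: mulVmx.
exact: rime_r_classical.
Qed.
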